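(* Consider the team setup of the scalar binary signaling problem described in the context (identical costs $C_{ji}=C^t_{ji}=C^r_{ji}$ and identical priors $\pi_i=\pi^t_i=\pi^r_i$, $i,j\in\{0,1\}$). Let $$\tau\triangleq\frac{\pi_0(C_{10}-C_{00})}{\pi_1(C_{01}-C_{11})}.$$ If $\tau\le 0$ or $\tau=\infty$, the team solution of the binary signaling setup is non-informative. Otherwise, i.e., if $0<\tau<\infty$, the team solution is always informative.
   Context: Binary signaling problem: there are two hypotheses $\mathcal H_0: Y=S_0+N$ and $\mathcal H_1: Y=S_1+N$, where $Y$ takes values in $\Gamma=\mathbb R$, $S_0,S_1\in\mathbb R$ are deterministic signals and $N\sim\mathcal N(0,\sigma^2)$, $\sigma>0$. The transmitter chooses $\mathcal S=\{S_0,S_1\}$ in $\mathbb S=\{\mathcal S: |S_0|^2\le P_0,\ |S_1|^2\le P_1\}$, with power limits $P_0,P_1>0$. The receiver chooses a decision rule $\delta\in\Delta$, i.e. a partition of $\Gamma$ into $\Gamma_0,\Gamma_1$, deciding $\mathcal H_i$ when $y\in\Gamma_i$. Put $\mathsf P_{ji}=\Pr(Y\in\Gamma_j\mid\mathcal H_i)$. The priors $\pi_0,\pi_1\ge0$ satisfy $\pi_0+\pi_1=1$, and $C_{ji}\ge 0$ is the cost of deciding $\mathcal H_j$ when $\mathcal H_i$ is true. The common Bayes risk is $$r(\mathcal S,\delta)=\pi_0(C_{00}\mathsf P_{00}+C_{10}\mathsf P_{10})+\pi_1(C_{01}\mathsf P_{01}+C_{11}\mathsf P_{11}).$$ A team solution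 is a pair $(\mathcal S^*,\delta^* )$ minimizing $r$ over $\mathbb S\times\Delta$. (Decision rules are understood up to Lebesgue-null sets of observations.) $\tau$ is an extended real number: when its denominator vanishes and its numerator does not, it equals $+\infty$ or $-\infty$ according to the sign of the numerator. A solution/equilibrium is called non-informative (babbling) if it is achieved with a message that is useless for the receiver, i.e. $S_0^*=S_1^*$ and $\delta^*$ uses only the priors, or $\delta^*$ ignores the observation $y$ and always decides the same hypothesis. Otherwise it is called informative: $S_0^*\ne S_1^*$ and $\delta^*$ depends on the observation. *)

(* Defs.v *)
From HB Require Import structures.
From mathcomp Require Import all_boot all_order all_algebra.
From mathcomp Require Import all_classical all_reals all_analysis.
Set Implicit Arguments.
Unset Strict Implicit.
Unset Printing Implicit Defensive.
Import Order.TTheory GRing.Theory Num.Theory.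
Import numFieldNormedType.Exports.
Local Open Scope classical_set_scope.
Local Open Scope ring_scope.

(* Hypotheses and decisions are both indexed by 'I_2. Two-index quantities
   follow the convention X_{ji}: decision j first, true hypothesis i second. *)

Section BinarySignaling.
Context {R : realType} {d : measure_display} {Omega : measurableType d}.
Variables (P : probability Omega R) (N : {RV P >-> R}).

Implicit Types (Pow S prior : 'I_2 -> R) (C : 'I_2 -> 'I_2 -> R).
Implicit Types G : 'I_2 -> set R.

Definition gaussian_noise (sigma : R) : Prop :=
  forall A : set R, measurable A ->
    distribution P N A = normal_prob 0 sigma A.

Definition admissible Pow S : Prop := forall i, `|S i| ^+ 2 <= Pow i.

Definition decision_rule G : Prop :=
  [/\ forall j, measurable (G j), G 0 `&` G 1 = set0 & G 0 `|` G 1 = setT].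

Definition decision_prob S G (j i : 'I_2) : R :=
  fine (P [set w | G j (S i + N w)]).

Definition bayes_risk prior C S G : R :=
  let p := decision_prob S G in
  prior 0 * (C 0 0 * p 0 0 + C 1 0 * p 1 0) +
  prior 1 * (C 0 1 * p 0 1 + C 1 1 * p 1 1).

Definition team_solution Pow prior C S G : Prop :=
  [/\ admissible Pow S, decision_rule G &
    forall S' G', admissible Pow S' -> decision_rule G' ->
      bayes_risk prior C S G <= bayes_risk prior C S' G'].

Definition tau_num prior C : R := prior 0 * (C 1 0 - C 0 0).
Definition tau_den prior C : R := prior 1 * (C 0 1 - C 1 1).

(* tau is not defined when it reads 0/0. *)
Definition tau_defined prior C : Prop :=
  tau_num prior C != 0 \/ tau_den prior C != 0.

(* Meaningful only under tau_defined: in the 0/0 case this returns a junk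
   value. *)
Definition tau prior C : \bar R :=
  if tau_den prior C != 0 then (tau_num prior C / tau_den prior C)%:E
  else if 0 < tau_num prior C then +oo%E else -oo%E.

Definition ignores_observation G : Prop :=
  exists j, {ae lebesgue_measure, forall y : R, G j y}.

(* A rule that uses only the priors does not look at y; being deterministic, it
   then decides the same hypothesis for (almost) every y. The first clause of
   the usual definition is therefore a special case of the second one. *)
Definition non_informative S G : Prop :=
  (S 0 = S 1 /\ ignores_observation G) \/ ignores_observation G.

Definition informative S G : Prop :=
  S 0 != S 1 /\ ~ ignores_observation G.

End BinarySignaling.

(* Main.v *)
Require Import Defs.
From HB Require Import structures.
From mathcomp Require Import all_boot all_order all_algebra.
From mathcomp Require Import all_classical all_reals all_analysis.
From mathcomp Require Import measurable_realfun lra ring.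
Import Order.TTheory GRing.Theory Num.Theory.
Import numFieldNormedType.Exports.
Local Open Scope classical_set_scope.
Local Open Scope ring_scope.

(** Let q(m, A) be the probability that a Gaussian of mean m and standard
deviation sigma falls in A, and let A be the region where the receiver decides
hypothesis 0. With a and b the numerator and denominator of tau, the Bayes risk
is a constant minus the gain a q(S_0, A) - b q(S_1, A) (bayes_risk_gain), so
team solutions are exactly the maximizers of the gain (team_solutionP).
Exchanging A with its complement changes the signs of both a and b
(gain_maximizer_setC), which leaves two cases.

If b <= 0 <= a and a, b are not both 0, the gain is largest when A has full
measure, whatever the signals, and since the Gaussian density is positive every
maximizer has this form (gain_maximizer_full): the receiver ignores y.

If a, b > 0, then for fixed signals the best A is the likelihood ratio region
where b phi(y - S_1) <= a phi(y - S_0) (gain_le_likelihood_ratio). For Gaussian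
densities this is a half-line c <= (S_0 - S_1) y (likelihood_ratio_affine).
Moving S_0 and S_1 apart as far as the power limits permit can only increase
the gain of that half-line, so every pair is dominated by one of two: extreme
signals in one of the two orders, each with its own likelihood ratio region.
The better of the two is a maximizer (exists_gain_maximizer_pos). With distinct
signals some region has positive gain and some region has gain above a - b
(exists_gain_gt0, exists_gain_gt_always). A null region has gain 0, a conull
one has gain a - b, and equal signals give (a - b) q(S_0, A), which lies between
0 and a - b; hence none of these is optimal (gain_maximizer_informative). *)

(** * Translates and null sets of the normal law *)

Section NormalProbability.
Set Implicit Arguments.
Unset Strict Implicit.
Context {R : realType}.
Implicit Types (m s a b t : R) (A B : set R).

Lemma measurable_shift m : measurable_fun [set: R] (+%R m).
Proof. exact: measurable_funD. Qed.

Lemma lebesgue_measure_shift m A : measurable A ->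
  pushforward lebesgue_measure (+%R m : _ -> measurableTypeR R) A =
  lebesgue_measure A.
Proof.
move=> mA.
apply/esym/lebesgue_measure_unique => //=; first exact: measurable_shift.
move=> mf _ [[a b]] _ <-; rewrite /pushforward/=.
rewrite [X in _ = lebesgue_measure X](_ : _ = `]a - m, b - m]%classic);
    last first.
  by apply/seteqP; split => x /=; rewrite !in_itv/= ltrBlDl lerBrDl.
rewrite !lebesgue_measure_itv/= !lte_fin ltrD2r.
by case: ifP => // _; rewrite -!EFinB; congr EFin; ring.
Qed.

Lemma measurable_EFin_normal_pdf m s A :
  measurable_fun A (EFin \o normal_pdf m s).
Proof.
by apply/measurable_funTS/measurable_EFinP; exact: measurable_normal_pdf.
Qed.

Lemma normal_prob_shift m s A : s != 0 -> measurable A ->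
  normal_prob 0 s [set x | A (m + x)] = normal_prob m s A.
Proof.
move=> s0 mA; rewrite /normal_prob.
transitivity (\int[pushforward lebesgue_measure
    (+%R m : _ -> measurableTypeR R)]_(y in A) (normal_pdf m s y)%:E)%E;
    last first.
  apply: eq_measure_integral => //=; first exact: measurable_shift.
  by move=> _ B mB _; exact: lebesgue_measure_shift.
rewrite ge0_integral_pushforward; last 4 first.
- exact: measurable_shift.
- exact: mA.
- exact: measurable_EFin_normal_pdf.
- by move=> y _; rewrite lee_fin normal_pdf_ge0.
apply: eq_integral => x _ /=; congr EFin.
by rewrite !normal_pdfE// [in RHS]normal_fun_center/= addrC addKr.
Qed.

Lemma normal_prob_eq0 m s A : s != 0 -> measurable A ->
  normal_prob m s A = 0%E -> lebesgue_measure A = 0%E.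
Proof.
move=> s0 mA A0.
have mpdf := @measurable_EFin_normal_pdf m s A.
have [] := (ae_eq_integral_abs lebesgue_measure mA mpdf).1.
  rewrite -A0; apply: eq_integral => x _.
  by rewrite gee0_abs// lee_fin normal_pdf_ge0.
move=> B [mB B0 AB].
apply: (@subset_measure0 _ _ _ lebesgue_measure A B) => // x Ax; apply: AB => /=.
move=> /(_ Ax)/eqP; rewrite eqe normal_pdfE// mulf_eq0.
by rewrite gt_eqF ?normal_peak_gt0// gt_eqF// expR_gt0.
Qed.

End NormalProbability.

(** * Probability of a decision region *)

(** The probability, as a real number, that a Gaussian observation of mean [m]
falls in [A]. It is locked so that conversion never unfolds the integral. *)
HB.lock Definition hit_prob {R : realType} (sigma m : R) (A : set R) : R :=
  fine (normal_prob m sigma A).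
Canonical hit_prob_unlockable := Unlockable hit_prob.unlock.

Section Gain.
Set Implicit Arguments.
Unset Strict Implicit.
Context {R : realType} (sigma : R).
Hypothesis sigma_gt0 : 0 < sigma.
Implicit Types (m a b c : R) (A B L : set R).

Let sigma_neq0 : sigma != 0. Proof. by rewrite gt_eqF. Qed.

Local Notation hit_prob := (hit_prob sigma).

Lemma hit_probK m A : measurable A ->
  (hit_prob m A)%:E = normal_prob m sigma A.
Proof. by move=> mA; rewrite unlock fineK// fin_num_measure. Qed.

Lemma hit_prob_ge0 m A : 0 <= hit_prob m A.
Proof. by rewrite unlock fine_ge0. Qed.

Lemma hit_prob_le1 m A : measurable A -> hit_prob m A <= 1.
Proof. by move=> mA; rewrite -lee_fin hit_probK// probability_le1. Qed.

Lemma hit_prob_setC m A : measurable A -> hit_prob m (~` A) = 1 - hit_prob m A.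
Proof.
move=> mA; apply: EFin_inj.
by rewrite EFinB !hit_probK ?probability_setC//; exact: measurableC.
Qed.

Lemma hit_prob_setT m : hit_prob m setT = 1.
Proof. by rewrite unlock probability_setT. Qed.

Lemma hit_probDI m A B : measurable A -> measurable B ->
  hit_prob m A = hit_prob m (A `\` B) + hit_prob m (A `&` B).
Proof.
move=> mA mB; apply: EFin_inj; rewrite EFinD !hit_probK//.
- exact: (measureDI (normal_prob m sigma) mA mB).
- exact: measurableI.
- exact: measurableD.
Qed.

(** The normal law and the Lebesgue measure have the same null sets. *)
Lemma hit_prob_eq0 m A : measurable A ->
  (hit_prob m A == 0) = (lebesgue_measure A == 0%E).
Proof.
move=> mA; apply/eqP/eqP => A0.
  apply: (@normal_prob_eq0 _ m sigma) => //.
  by rewrite -hit_probK// A0.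
apply: EFin_inj; rewrite hit_probK//.
by have /null_content_dominatesP := @normal_prob_dominates R m sigma; exact.
Qed.

(** A pointwise inequality between weighted densities passes to the weighted
probabilities. *)
Lemma ler_hit_prob m0 m1 a b A : 0 <= a -> 0 <= b -> measurable A ->
  (forall y, A y -> b * normal_pdf m1 sigma y <= a * normal_pdf m0 sigma y) ->
  b * hit_prob m1 A <= a * hit_prob m0 A.
Proof.
move=> a0 b0 mA ba; rewrite -lee_fin !EFinM (hit_probK m0 mA) (hit_probK m1 mA).
have scale m k : 0 <= k -> (k%:E * normal_prob m sigma A =
    \int[lebesgue_measure]_(x in A) (k * normal_pdf m sigma x)%:E)%E.
  move=> k0; rewrite -ge0_integralZl_EFin; last 4 first.
  - exact: mA.
  - by move=> x _; rewrite lee_fin normal_pdf_ge0.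
  - exact: measurable_EFin_normal_pdf.
  - exact: k0.
  by apply: eq_integral => x _; rewrite EFinM.
rewrite (scale _ _ a0) (scale _ _ b0); apply: ge0_le_integral; first exact: mA.
- by move=> x _; rewrite lee_fin mulr_ge0// normal_pdf_ge0.
- by apply/measurable_funTS/measurable_EFinP/measurable_funM => //;
    exact: measurable_normal_pdf.
- by apply/measurable_funTS/measurable_EFinP/measurable_funM => //;
    exact: measurable_normal_pdf.
- by move=> y Ay; rewrite lee_fin; exact: ba.
Qed.

(** * Gain of a decision region and the likelihood ratio test *)

(** The part of the negated risk that depends on the strategies, when
hypothesis 0, with mean [m0], is decided on [A]. *)
Definition gain a b m0 m1 A : R := a * hit_prob m0 A - b * hit_prob m1 A.

Lemma gain_setC a b m0 m1 A : measurable A ->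
  gain a b m0 m1 (~` A) = a - b + gain (- a) (- b) m0 m1 A.
Proof. by move=> mA; rewrite /gain !hit_prob_setC//; ring. Qed.

(** Optimality of the likelihood ratio region: passing from [A] to [L] adds
points where the integrand of the gain is nonnegative and removes points where
it is negative. *)
Lemma gain_le_likelihood_ratio a b m0 m1 A L : 0 <= a -> 0 <= b ->
  measurable A -> measurable L ->
  (forall y,
    L y <-> b * normal_pdf m1 sigma y <= a * normal_pdf m0 sigma y) ->
  gain a b m0 m1 A <= gain a b m0 m1 L.
Proof.
move=> a0 b0 mA mL LE; rewrite /gain.
rewrite !(hit_probDI _ mA mL) !(hit_probDI _ mL mA) (setIC L A).
have LA : b * hit_prob m1 (L `\` A) <= a * hit_prob m0 (L `\` A).
  by apply: ler_hit_prob => //; [exact: measurableD | move=> y [/LE]].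
have AL : a * hit_prob m0 (A `\` L) <= b * hit_prob m1 (A `\` L).
  apply: ler_hit_prob => //; first exact: measurableD.
  by move=> y [_ Ly]; apply/ltW; rewrite ltNge; apply/negP => /LE.
lra.
Qed.

(** The quadratic terms in [y] of the two Gaussian exponents cancel. The case
[m0 = m1] is included. *)
Lemma likelihood_ratio_affine a b m0 m1 : 0 < a -> 0 < b -> exists c, forall y,
  (b * normal_pdf m1 sigma y <= a * normal_pdf m0 sigma y) =
  (c <= (m0 - m1) * y).
Proof.
move=> a0 b0.
exists (sigma ^+ 2 * (ln b - ln a) + (m0 ^+ 2 - m1 ^+ 2) / 2) => y.
rewrite !normal_pdfE// !mulrA ![_ * normal_peak _]mulrC -!mulrA.
rewrite ler_pM2l ?normal_peak_gt0// /normal_fun.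
rewrite -{1}(lnK b0) -{1}(lnK a0) -!expRD ler_expR.
rewrite -subr_ge0 -[RHS]subr_ge0.
rewrite -(pmulr_rge0 _ (exprn_gt0 2 sigma_gt0)); congr (0 <= _).
by field.
Qed.

(** A closed half-line, unbounded in the direction of the sign of [d]. For
[d = 0] it degenerates to the whole line or to the empty set. *)
Definition half_line d c : set R := [set y | c <= d * y].

Lemma measurable_half_line d c : measurable (half_line d c).
Proof.
rewrite /half_line -[X in measurable X]setTI.
have mf : measurable_fun setT (fun y : R => c <= d * y).
  by apply: measurable_fun_ler => //; exact: measurable_funM.
exact: (mf measurableT [set true]).
Qed.

Lemma hit_prob_half_line_gt0 m d c : d != 0 -> 0 < hit_prob m (half_line d c).
Proof.
move=> d0; rewrite lt_def hit_prob_ge0 andbT hit_prob_eq0; last first.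
  exact: measurable_half_line.
apply/negP => /eqP L0.
have [i [ii Li]] : exists i : interval R,
    lebesgue_measure [set` i] = 1%E /\ [set` i] `<=` half_line d c.
  have [dp|dn|/eqP] := ltgtP d 0; last by rewrite (negbTE d0).
  - exists `[c / d - 1, c / d]; split.
      by rewrite lebesgue_measure_itv/= lte_fin ltrBlDr ltrDl ltr01 -EFinB subKr.
    move=> y /=; rewrite in_itv/= => /andP[_].
    by rewrite /half_line/= ler_ndivlMr// mulrC.
  - exists `[c / d, c / d + 1]; split.
      by rewrite lebesgue_measure_itv/= lte_fin ltrDl ltr01 -EFinB addrC addKr.
    move=> y /=; rewrite in_itv/= => /andP[+ _].
    by rewrite /half_line/= ler_pdivrMr// mulrC.
have i0 : lebesgue_measure [set` i] = 0%E.
  apply: (@subset_measure0 _ _ _ lebesgue_measure _ (half_line d c)) => //.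
  exact: measurable_half_line.
by have /eqP := etrans (esym ii) i0; rewrite onee_eq0.
Qed.

(** Moving the mean towards the unbounded end of a half-line increases the
probability of the half-line. *)
Lemma le_hit_prob_half_line d c m m' : d * m <= d * m' ->
  hit_prob m (half_line d c) <= hit_prob m' (half_line d c).
Proof.
move=> dm; have mL := measurable_half_line d c.
have mS u : measurable [set x | half_line d c (u + x)].
  by rewrite -[X in measurable X]setTI; exact: measurable_shift.
rewrite -lee_fin !(hit_probK _ mL).
rewrite -(normal_prob_shift m sigma_neq0 mL).
rewrite -(normal_prob_shift m' sigma_neq0 mL).
apply: le_measure; [exact: mem_set (mS m) | exact: mem_set (mS m') |].
move=> x /= /le_trans; apply.
by rewrite !mulrDr lerD2r.
Qed.

Lemma exists_gain_gt0 a b m0 m1 : 0 < a -> 0 < b -> m0 != m1 ->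
  exists2 A, measurable A & 0 < gain a b m0 m1 A.
Proof.
move=> a0 b0 m01.
(* Testing with weight [2 * b] instead of [b] leaves a margin of at least
   [b * hit_prob m1 L], which is positive. *)
have b20 : 0 < 2 * b by rewrite mulr_gt0.
have [c cE] := likelihood_ratio_affine m0 m1 a0 b20.
have mL := measurable_half_line (m0 - m1) c.
exists (half_line (m0 - m1) c) => //.
have : 0 < hit_prob m1 (half_line (m0 - m1) c).
  by apply: hit_prob_half_line_gt0; rewrite subr_eq0.
have : 2 * b * hit_prob m1 (half_line (m0 - m1) c) <=
    a * hit_prob m0 (half_line (m0 - m1) c).
  by apply: ler_hit_prob => //; [exact: ltW | exact: ltW | move=> y; rewrite cE].
rewrite /gain; nra.
Qed.

(** [a - b] is the gain of always deciding hypothesis 0. *)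
Lemma exists_gain_gt_always a b m0 m1 : 0 < a -> 0 < b -> m0 != m1 ->
  exists2 A, measurable A & a - b < gain a b m0 m1 A.
Proof.
move=> a0 b0 m01; rewrite eq_sym in m01.
have [B mB B0] := exists_gain_gt0 b0 a0 m01.
exists (~` B); first exact: measurableC.
by rewrite gain_setC//; move: B0; rewrite /gain; lra.
Qed.

(** * Maximizers of the gain under power limits *)

(** [S] and [A] jointly maximize the gain over admissible signals and
measurable regions. *)
Definition gain_maximizer (Pow : 'I_2 -> R) a b (S : 'I_2 -> R) A : Prop :=
  [/\ admissible Pow S, measurable A &
    forall S' A', admissible Pow S' -> measurable A' ->
      gain a b (S' 0) (S' 1) A' <= gain a b (S 0) (S 1) A].

Lemma gain_maximizer_setC Pow a b S A :
  gain_maximizer Pow a b S A -> gain_maximizer Pow (- a) (- b) S (~` A).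
Proof.
move=> [aS mA max]; split => //; first exact: measurableC.
move=> S' A' aS' mA'.
have := max S' (~` A') aS' (measurableC mA').
rewrite !gain_setC//; rewrite /gain; lra.
Qed.

(** A maximizer is found among two candidates: the signals at the extreme
amplitudes, in either order, each with its likelihood ratio region. *)
Lemma exists_gain_maximizer_pos (Pow : 'I_2 -> R) a b : (forall i, 0 < Pow i) ->
  0 < a -> 0 < b -> exists S A, gain_maximizer Pow a b S A.
Proof.
move=> P0 a0 b0.
pose r (i : 'I_2) : R := Num.sqrt (Pow i).
pose Sp (i : 'I_2) : R := if i == 0 then r 0 else - r 1.
pose Sn i := - Sp i.
have aSp : admissible Pow Sp.
  by move=> i; rewrite real_normK ?num_real// /Sp; case: eqVneq => [->|];
    [|case: i => -[|[|]]// p _; rewrite sqrrN (_ : Ordinal p = 1);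
      last exact: val_inj];
    rewrite sqr_sqrtr// ltW.
have aSn : admissible Pow Sn by move=> i; rewrite /Sn normrN; exact: aSp.
have bound S : admissible Pow S -> forall i, - r i <= S i <= r i.
  move=> aS i; rewrite -ler_norml -sqrtr_sqr ler_sqrt; last exact/ltW/P0.
  by rewrite -real_normK ?num_real//; exact: aS.
have opt (S : 'I_2 -> R) : exists2 L, measurable L &
    forall A, measurable A -> gain a b (S 0) (S 1) A <= gain a b (S 0) (S 1) L.
  have [c cE] := likelihood_ratio_affine (S 0) (S 1) a0 b0.
  exists (half_line (S 0 - S 1) c); first exact: measurable_half_line.
  move=> A mA; apply: gain_le_likelihood_ratio => //; try exact: ltW.
    exact: measurable_half_line.
  by move=> y; rewrite cE.
have [Lp mLp optp] := opt Sp; have [Ln mLn optn] := opt Sn.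
have dom (S : 'I_2 -> R) A : admissible Pow S -> measurable A ->
    gain a b (S 0) (S 1) A <= gain a b (Sp 0) (Sp 1) Lp \/
    gain a b (S 0) (S 1) A <= gain a b (Sn 0) (Sn 1) Ln.
  move=> aS mA.
  have /andP[S0l S0u] := bound S aS 0; have /andP[S1l S1u] := bound S aS 1.
  have [c cE] := likelihood_ratio_affine (S 0) (S 1) a0 b0.
  have mL := measurable_half_line (S 0 - S 1) c.
  have AL : gain a b (S 0) (S 1) A <=
      gain a b (S 0) (S 1) (half_line (S 0 - S 1) c).
    apply: gain_le_likelihood_ratio => //; try exact: ltW.
    by move=> y; rewrite cE.
  have push e0 e1 : (S 0 - S 1) * S 0 <= (S 0 - S 1) * e0 ->
      (S 0 - S 1) * e1 <= (S 0 - S 1) * S 1 ->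
      gain a b (S 0) (S 1) A <= gain a b e0 e1 (half_line (S 0 - S 1) c).
    move=> h0 h1; apply: (le_trans AL); rewrite /gain lerB//.
    - by rewrite ler_pM2l// le_hit_prob_half_line.
    - by rewrite ler_pM2l// le_hit_prob_half_line.
  (* If [S 0 = S 1] the half-line is degenerate and both candidates dominate. *)
  have [d0|d0] := leP 0 (S 0 - S 1); [left|right].
  - apply: le_trans (optp _ mL); apply: push; rewrite /Sp/=; nra.
  - apply: le_trans (optn _ mL); apply: push; rewrite /Sn /Sp/=; nra.
have [np|pn] := leP (gain a b (Sn 0) (Sn 1) Ln) (gain a b (Sp 0) (Sp 1) Lp).
- exists Sp, Lp; split => // S A aS mA.
  by case: (dom S A aS mA) => // /le_trans; exact.
- exists Sn, Ln; split => // S A aS mA.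
  by case: (dom S A aS mA) => // /le_trans; apply; exact: ltW.
Qed.

Lemma exists_gain_maximizer (Pow : 'I_2 -> R) a b : (forall i, 0 < Pow i) ->
  exists S A, gain_maximizer Pow a b S A.
Proof.
move=> P0.
have opp u v : (exists S A, gain_maximizer Pow (- u) (- v) S A) ->
    exists S A, gain_maximizer Pow u v S A.
  move=> [S [A /gain_maximizer_setC]]; rewrite !opprK => ?.
  by exists S, (~` A).
(* When [v <= 0 <= u], always deciding hypothesis 0 is optimal. *)
have trivial u v : v <= 0 -> 0 <= u -> exists S A, gain_maximizer Pow u v S A.
  move=> v0 u0; exists (fun=> 0), setT; split => //.
    by move=> i; rewrite normr0 expr0n/= ltW.
  move=> S A _ mA; rewrite /gain !hit_prob_setT.
  have := hit_prob_le1 (S 0) mA; have := hit_prob_le1 (S 1) mA; nra.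
have [a0|a0] := leP a 0; have [b0|b0] := leP b 0.
- have [->|an0] := eqVneq a 0; first exact: trivial.
  have [->|bn0] := eqVneq b 0.
    by apply: opp; apply: trivial; rewrite ?oppr0// oppr_ge0.
  by apply/opp/exists_gain_maximizer_pos => //;
    rewrite oppr_gt0 lt_neqAle ?an0 ?bn0.
- by apply: opp; apply: trivial; rewrite ?oppr_le0 ?oppr_ge0// ltW.
- by apply: trivial => //; exact: ltW.
- exact: exists_gain_maximizer_pos.
Qed.

(** When [b <= 0 <= a], a maximizer must decide hypothesis 0 almost
everywhere. *)
Lemma gain_maximizer_full Pow a b S A : (forall i, 0 < Pow i) ->
  0 <= a -> b <= 0 -> (a != 0) || (b != 0) ->
  gain_maximizer Pow a b S A -> lebesgue_measure (~` A) = 0%E.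
Proof.
move=> P0 a0 b0 ab [_ mA /(_ (fun=> 0) setT)].
rewrite /gain !hit_prob_setT => max.
have mC := measurableC mA; apply/eqP.
have h0 := hit_prob_le1 (S 0) mA; have h1 := hit_prob_le1 (S 1) mA.
have {}max : a * 1 - b * 1 <= a * hit_prob (S 0) A - b * hit_prob (S 1) A.
  by apply: max => // i; rewrite normr0 expr0n/= ltW.
have ha : a * (1 - hit_prob (S 0) A) = 0 by nra.
have hb : b * (1 - hit_prob (S 1) A) = 0 by nra.
case/orP: ab => n0.
- move/eqP: ha; rewrite mulf_eq0 (negbTE n0)/= -hit_prob_setC//.
  by rewrite hit_prob_eq0.
- move/eqP: hb; rewrite mulf_eq0 (negbTE n0)/= -hit_prob_setC//.
  by rewrite hit_prob_eq0.
Qed.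

(** When [a] and [b] are positive, a maximizer uses distinct signals and both
decisions occur on sets of positive measure. *)
Lemma gain_maximizer_informative Pow a b S A : (forall i, 0 < Pow i) ->
  0 < a -> 0 < b -> gain_maximizer Pow a b S A ->
  [/\ S 0 != S 1, lebesgue_measure A != 0%E & lebesgue_measure (~` A) != 0%E].
Proof.
move=> P0 a0 b0 [_ mA max].
pose e i := if i == 0 :> 'I_2 then Num.sqrt (Pow 0) else 0.
have ae : admissible Pow e.
  move=> i; rewrite real_normK ?num_real// /e; case: eqVneq => [->|_].
    by rewrite sqr_sqrtr// ltW.
  by rewrite expr0n/= ltW.
have e01 : e 0 != e 1 by rewrite /e/= gt_eqF// sqrtr_gt0.
have gt0 : 0 < gain a b (S 0) (S 1) A.
  by have [B mB /lt_le_trans] := exists_gain_gt0 a0 b0 e01; apply; exact: max.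
have gtab : a - b < gain a b (S 0) (S 1) A.
  by have [B mB /lt_le_trans] := exists_gain_gt_always a0 b0 e01;
    apply; exact: max.
split.
- apply/eqP => S01; move: gt0 gtab; rewrite /gain S01.
  have := hit_prob_le1 (S 1) mA; have := hit_prob_ge0 (S 1) A;
    have [ab|ab] := leP a b; nra.
- apply/negP; rewrite -(hit_prob_eq0 (S 0))// => /eqP h0.
  move: gt0; rewrite /gain h0; have := hit_prob_ge0 (S 1) A; nra.
- have mC := measurableC mA.
  apply/negP; rewrite -(hit_prob_eq0 (S 1))// hit_prob_setC// => /eqP h1.
  by move: gtab; rewrite /gain; have := hit_prob_le1 (S 0) mA; nra.
Qed.

End Gain.

(** * From Bayes risk to gain *)

Section TeamProblem.
Set Implicit Arguments.
Unset Strict Implicit.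
Context {R : realType} {d : measure_display} {Omega : measurableType d}.
Variables (P : probability Omega R) (N : {RV P >-> R}) (sigma : R).
Hypotheses (sigma_gt0 : 0 < sigma) (gaussN : gaussian_noise N sigma).
Implicit Types (Pow S prior : 'I_2 -> R) (C : 'I_2 -> 'I_2 -> R).
Implicit Types (G : 'I_2 -> set R) (A : set R).

Lemma decision_probE S G j i : measurable (G j) ->
  decision_prob N S G j i = hit_prob sigma (S i) (G j).
Proof.
move=> mG; rewrite /decision_prob unlock.
rewrite -normal_prob_shift ?gt_eqF// -gaussN//.
by rewrite -[X in measurable X]setTI; exact: measurable_shift.
Qed.

(** The rule that decides hypothesis 0 exactly on [A]. *)
Definition region_rule A (j : 'I_2) : set R := if j == 0 then A else ~` A.

Lemma decision_rule_region A : measurable A -> decision_rule (region_rule A).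
Proof.
move=> mA; rewrite /region_rule; split => /=.
- by move=> j; case: ifP => // _; exact: measurableC.
- exact: setICr.
- exact: setUCr.
Qed.

Lemma decision_rule_setC G : decision_rule G -> G 1 = ~` G 0.
Proof.
move=> [_ G01 GT]; apply/seteqP; split => y.
  by move=> G1y G0y; have : set0 y by rewrite -G01.
by move=> nG0; have : setT y by []; rewrite -GT => -[].
Qed.

Lemma bayes_risk_gain prior C S G : decision_rule G ->
  bayes_risk N prior C S G = prior 0 * C 1 0 + prior 1 * C 1 1 -
    gain sigma (tau_num prior C) (tau_den prior C) (S 0) (S 1) (G 0).
Proof.
move=> rG; have [mG _ _] := rG; rewrite /bayes_risk !decision_probE//.
rewrite (decision_rule_setC rG) !hit_prob_setC// /gain /tau_num /tau_den; ring.
Qed.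

Lemma team_solutionP Pow prior C S G : team_solution N Pow prior C S G <->
  decision_rule G /\
  gain_maximizer sigma Pow (tau_num prior C) (tau_den prior C) S (G 0).
Proof.
split=> [[aS rG min]|[rG [aS mG max]]].
  have [mG _ _] := rG; split => //; split => // S' A' aS' mA'.
  have := min S' (region_rule A') aS' (decision_rule_region mA').
  by rewrite !bayes_risk_gain//;
    [rewrite lerD2l lerN2 | exact: decision_rule_region].
split => // S' G' aS' rG'; rewrite !bayes_risk_gain// lerD2l lerN2.
by apply: max => //; case: rG'.
Qed.

Lemma ignores_observationP G : decision_rule G -> ignores_observation G <->
  (lebesgue_measure (~` G 0) = 0%E \/ lebesgue_measure (G 0) = 0%E).
Proof.
move=> rG; have [mG _ _] := rG; have mC := measurableC (mG 0).
have G1 := decision_rule_setC rG.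
split=> [[j /negligibleP Gj]|[G0|G0]].
- have := Gj (measurableC (mG j)); case: j Gj => -[|[|//]] p Gj.
  + by rewrite (_ : Ordinal p = 0); [left | exact: val_inj].
  + by rewrite (_ : Ordinal p = 1); [rewrite G1 setCK; right | exact: val_inj].
- by exists 0; apply/negligibleP.
- exists 1; apply/negligibleP; first exact: (measurableC (mG 1)).
  by rewrite -[RHS]G0 -[in RHS](setCK (G 0)) -G1.
Qed.

End TeamProblem.

Theorem theorem2p1 (R : realType) (d : measure_display)
    (Omega : measurableType d) (P : probability Omega R) (N : {RV P >-> R})
    (sigma : R) (Pow prior : 'I_2 -> R) (C : 'I_2 -> 'I_2 -> R) :
  0 < sigma ->
  gaussian_noise N sigma ->
  (forall i, 0 < Pow i) ->
  (forall i, 0 <= prior i) -> prior 0 + prior 1 = 1 ->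
  (forall j i, 0 <= C j i) ->
  tau_defined prior C ->
  (exists S G, team_solution N Pow prior C S G) /\
  ((tau prior C <= 0)%E \/ tau prior C = +oo%E ->
     forall S G, team_solution N Pow prior C S G -> non_informative S G) /\
  ((0 < tau prior C)%E /\ (tau prior C < +oo)%E ->
     forall S G, team_solution N Pow prior C S G -> informative S G).
Proof.
move=> s0 gN P0 _ _ _; rewrite /tau_defined /tau.
have tsP := team_solutionP s0 gN Pow prior C.
move: (tau_num prior C) (tau_den prior C) tsP => a b tsP ab.
split; [|split].
- have [S [A maxA]] := exists_gain_maximizer s0 a b P0.
  exists S, (region_rule A); apply/tsP; split => //.
  by apply: decision_rule_region; case: maxA.
- move=> tau_le S G /tsP[rG maxG]; right; apply/(ignores_observationP rG).
  have abn0 : (a != 0) || (b != 0) by apply/orP.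
  have [[a0 b0]|[a0 b0]] : (0 <= a /\ b <= 0) \/ (a <= 0 /\ 0 <= b).
  + case: tau_le; have [->|bn0]/= := eqVneq b 0.
    * by case: ltP => // a0 _; right.
    * rewrite lee_fin => ab0.
      have := divfK bn0 a.
      by move: bn0; rewrite neq_lt => /orP[b0|b0]; [left|right]; nra.
    * by case: ltP => // a0 _; left; split => //; exact: ltW.
    * by [].
  + by left; exact: (gain_maximizer_full s0 P0 a0 b0 abn0 maxG).
  + have a0' : 0 <= - a by rewrite oppr_ge0.
    have b0' : - b <= 0 by rewrite oppr_le0.
    have abn0' : (- a != 0) || (- b != 0) by rewrite !oppr_eq0.
    right; rewrite -[G 0]setCK.
    exact: (gain_maximizer_full s0 P0 a0' b0' abn0'
      (gain_maximizer_setC maxG)).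
- move=> [tau_gt0 tau_lty] S G /tsP[rG maxG].
  have [[a0 b0]|[a0 b0]] : (0 < a /\ 0 < b) \/ (a < 0 /\ b < 0).
  + move: tau_gt0 tau_lty; have [->|bn0]/= := eqVneq b 0.
      by case: ifP => //; rewrite ltxx.
    rewrite lte_fin => ab0 _; have := divfK bn0 a.
    by move: bn0; rewrite neq_lt => /orP[b0|b0]; [right|left]; nra.
  + have [S01 /eqP G0 /eqP G1] := gain_maximizer_informative s0 P0 a0 b0 maxG.
    by split=> // /(ignores_observationP rG)[].
  + have a0' : 0 < - a by rewrite oppr_gt0.
    have b0' : 0 < - b by rewrite oppr_gt0.
    have [S01 /eqP G0 /eqP] := gain_maximizer_informative s0 P0 a0' b0'
      (gain_maximizer_setC maxG).
    rewrite setCK => G1.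
    by split=> // /(ignores_observationP rG)[].
Qed.
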